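(* Let $p\ge 5$ be a prime and let $r,s,n$ be positive integers with $r\ge 2$. Then \[ D_{np}^{(r,s)}\equiv D_n^{(r,s)}+p^3B_{p-3}\,\mathcal{D}^{(r,s)}_n\pmod{p^4}, \] where $\mathcal{D}^{(r,s)}_n$ (independent of $p$) is given as follows. For $(r,s)=(2,1)$: \[ \mathcal{D}^{(2,1)}_n=8\sum_{k=0}^{n-1}\binom{n}{k}^2\binom{2k}{k}\binom{2n-2k-2}{n-k-1}n(n-k)^2-\frac{1}{3}\sum_{k=0}^n\binom{n}{k}^2\binom{2k}{k}\binom{2n-2k}{n-k}\bigl(2nk(n-k)+2k^3+2(n-k)^3\bigr), \] and for $r+s\ge 4$: \[ \mathcal{D}^{(r,s)}_n=-\frac{1}{3}\sum_{k=0}^n\binom{n}{k}^r\left(\binom{2k}{k}\binom{2n-2k}{n-k}\right)^s\bigl(rnk(n-k)+2sk^3+2s(n-k)^3\bigr). \]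
   Context: For $n\in\mathbb{N}$ and positive integers $r,s$, define $D_n^{(r,s)}=\sum_{k=0}^n\binom{n}{k}^r\left(\binom{2k}{k}\binom{2n-2k}{n-k}\right)^s$ (so $D_n^{(2,1)}$ are the Domb numbers). The Bernoulli numbers $B_m$ are defined by $\frac{z}{e^z-1}=\sum_{m\ge0}B_m\frac{z^m}{m!}$. For rationals $a,b$, $a\equiv b\pmod{p^m}$ means $(a-b)/p^m$ is a rational number whose denominator is not divisible by $p$. *)

(* Defs.v *)
From HB Require Import structures.
From mathcomp Require Import all_boot all_order all_algebra.
Set Implicit Arguments. Unset Strict Implicit. Unset Printing Implicit Defensive.
Import Order.TTheory GRing.Theory Num.Theory.
Local Open Scope ring_scope.

(* Bernoulli numbers with z/(e^z-1) convention: B_0 = 1 and, for m >= 1,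
   sum_{k=0}^{m} C(m+1,k) B_k = 0, i.e. B_m = -1/(m+1) sum_{k<m} C(m+1,k) B_k.
   bern_list m = [:: B_0; ...; B_m]. *)
Fixpoint bern_list (m : nat) : seq rat :=
  match m with
  | 0 => [:: 1]
  | m'.+1 =>
      let s := bern_list m' in
      rcons s (- (m'.+2%:R)^-1 *
               \sum_(k < m'.+1) ('C(m'.+2, k))%:R * nth 0 s k)
  end.

Definition bernoulli (m : nat) : rat := nth 0 (bern_list m) m.

Definition rat_congr (p m : nat) (a b : rat) : Prop :=
  ~~ ((p%:Z %| denq ((a - b) / (p ^ m)%:R))%Z).

Definition Drs (r s n : nat) : rat :=
  (\sum_(k < n.+1) ('C(n, k) ^ r * ('C(2 * k, k) * 'C(2 * n - 2 * k, n - k)) ^ s)%N%:R).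

Definition calD (r s n : nat) : rat :=
  if (r == 2%N) && (s == 1%N) then
    8%:R * (\sum_(k < n)
       ('C(n, k) ^ 2 * 'C(2 * k, k) * 'C(2 * n - 2 * k - 2, n - k - 1)
          * n * (n - k) ^ 2)%N%:R)
    - (3%:R)^-1 * (\sum_(k < n.+1)
       ('C(n, k) ^ 2 * 'C(2 * k, k) * 'C(2 * n - 2 * k, n - k)
          * (2 * n * k * (n - k) + 2 * k ^ 3 + 2 * (n - k) ^ 3))%N%:R)
  else
    - (3%:R)^-1 * (\sum_(k < n.+1)
       ('C(n, k) ^ r * ('C(2 * k, k) * 'C(2 * n - 2 * k, n - k)) ^ s
          * (r * n * k * (n - k) + 2 * s * k ^ 3 + 2 * s * (n - k) ^ 3))%N%:R).

(* Main.v *)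
(* Work in Z/p^4, where q = p satisfies q^4 = 0 and every integer prime to p is a
   unit; congruences modulo p become identities between multiples of q^3. Write
   h = (p-1)/2 and let H be the sum of 1/i^3 over 1 <= i <= h.

   Splitting a sum over 0 < j < p either as {i, p-i} or as {2i, p-2i}, i <= h,
   gives two linear relations. For f(j) = j^(p-3), whose sum over j < p is
   p B_(p-3) modulo p^2, they give H = -2 B_(p-3) mod p; for f(j) = 1/j^2 they
   express p^2 W, with W the sum of 1/(i(p-i)) over i <= h, as p^3 H / 6.

   Pairing the factors j and p-j of block i = prod_(0<j<p) (ip+j) gives
   block i = block 0 * (1 + i(i+1) p^2 W), because q^4 = 0; taking products,
   C(np,kp) = C(n,k) (1 + nk(n-k) p^2 W). This accounts for the terms of D_(np)
   whose index is a multiple of p. An index m = kp+j with 0 < j < p gives a term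
   divisible by p^(r+s), hence zero unless (r,s) = (2,1); in that case the
   p-free parts of the factorials modulo p yield a multiple of p^3 / j^3, and
   the sum over j is again a multiple of p^3 H. *)
Require Import Defs.
From HB Require Import structures.
From mathcomp Require Import all_boot all_order all_algebra.
From mathcomp Require Import zify ring.
Set Implicit Arguments. Unset Strict Implicit.
Unset Printing Implicit Defensive.
Import Order.TTheory GRing.Theory Num.Theory.
Local Open Scope ring_scope.

Lemma eq_cancel (w a b x y : nat) : (0 < w)%N ->
  a = b -> (a = w * x)%N -> (b = w * y)%N -> x = y.
Proof. by move=> w_gt0 -> -> /eqP; rewrite eqn_pmul2l // => /eqP. Qed.

(** * Factorials with the factors p removed *)

Section BlockFactorial.
Local Open Scope nat_scope.
Variable p : nat.
Hypothesis p_gt0 : 0 < p.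

Definition block i := \prod_(1 <= j < p) (i * p + j).

(** For [b < p] this is the product of the integers up to [a * p + b] that are not divisible by [p],
    taken block by block. *)
Definition pfree_fact a b :=
  (\prod_(i < a) block i) * \prod_(1 <= j < b.+1) (a * p + j).

Lemma pfree_fact0 a : pfree_fact a 0 = \prod_(i < a) block i.
Proof. by rewrite /pfree_fact big_geq // muln1. Qed.

Lemma pfree_factS a b : pfree_fact a b.+1 = pfree_fact a b * (a * p + b.+1).
Proof. by rewrite /pfree_fact big_nat_recr //= mulnA. Qed.

Lemma pfree_fact_block a : pfree_fact a p.-1 = pfree_fact a.+1 0.
Proof. by rewrite pfree_fact0 big_ord_recr /= /pfree_fact prednK. Qed.

(** The multiples of [p] up to [a * p] contribute the factorial of [a] times [p ^ a]. Later
    multiples stay inside [pfree_fact], so [b] may be arbitrary. *)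
Lemma fact_block a b : (a * p + b)`! = a`! * p ^ a * pfree_fact a b.
Proof.
suff fact_mulp c : (c * p)`! = c`! * p ^ c * pfree_fact c 0.
  elim: b => [|b IHb]; first by rewrite addn0.
  by rewrite addnS factS IHb pfree_factS addnS; ring.
elim: c => [|c IHc]; first by rewrite pfree_fact0 big_ord0.
have fact_lt d : (c * p + d)`! = c`! * p ^ c * pfree_fact c d.
  elim: d => [|d IHd]; first by rewrite addn0.
  by rewrite addnS factS IHd pfree_factS addnS; ring.
have -> : c.+1 * p = (c * p + p.-1).+1 by rewrite mulSn; lia.
rewrite factS fact_lt pfree_fact_block factS expnS.
have -> : (c * p + p.-1).+1 = c.+1 * p by rewrite mulSn; lia.
ring.
Qed.

Lemma fact_mulp a : (a * p)`! = a`! * p ^ a * pfree_fact a 0.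
Proof. by rewrite -fact_block addn0. Qed.

Lemma bin_block n k : k <= n ->
  'C(n * p, k * p) * (pfree_fact k 0 * pfree_fact (n - k) 0) =
  'C(n, k) * pfree_fact n 0.
Proof.
move=> le_kn; have le_knp : k * p <= n * p by rewrite leq_mul2r le_kn orbT.
have := bin_fact le_knp; rewrite -mulnBl.
rewrite !fact_mulp.
have -> : p ^ n = p ^ k * p ^ (n - k) by rewrite -expnD subnKC.
rewrite -(bin_fact le_kn).
set u := k`!; set v := (n - k)`!; set P := p ^ k; set Q := p ^ (n - k) => E.
have w_gt0 : 0 < u * v * P * Q by rewrite !muln_gt0 !fact_gt0 !expn_gt0 p_gt0.
by apply: (eq_cancel w_gt0 E); ring.
Qed.

(** The complementary index is [N * p + (p - j)], so the lower factorials contain only [p ^ (k + N)]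
    against [p ^ (k + N.+1)] above: one factor [p] survives. *)
Lemma bin_offblock k N j : j < p ->
  'C((k + N.+1) * p, k * p + j) * (pfree_fact k j * pfree_fact N (p - j)) =
  (k + N.+1) * 'C(k + N, k) * p * pfree_fact (k + N.+1) 0.
Proof.
move=> lt_jp.
have le_kjn : k * p + j <= (k + N.+1) * p by rewrite mulnDl mulSn; lia.
have := bin_fact le_kjn.
have -> : (k + N.+1) * p - (k * p + j) = N * p + (p - j)
  by rewrite mulnDl mulSn; lia.
rewrite fact_mulp !fact_block.
have := bin_fact (leq_addr N k); rewrite addKn addnS factS expnS expnD => <-.
set u := k`!; set v := N`!; set P := p ^ k; set Q := p ^ N => E.
have w_gt0 : 0 < u * v * P * Q by rewrite !muln_gt0 !fact_gt0 !expn_gt0 p_gt0.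
by apply: (eq_cancel w_gt0 E); ring.
Qed.

Lemma bin_double_block k j :
  'C(2 * (k * p + j), k * p + j) * pfree_fact k j ^ 2 =
  'C(2 * k, k) * pfree_fact (2 * k) (2 * j).
Proof.
have le_m m : m <= 2 * m by rewrite leq_pmull.
have := bin_fact (le_m (k * p + j)).
have -> m : 2 * m - m = m by lia.
have -> : 2 * (k * p + j) = 2 * k * p + 2 * j by ring.
rewrite !fact_block.
have := bin_fact (le_m k); have -> m : 2 * m - m = m by lia.
move=> <-; have -> : p ^ (2 * k) = p ^ k * p ^ k by rewrite mul2n -addnn expnD.
set u := k`!; set P := p ^ k => E.
have w_gt0 : 0 < u * u * P * P by rewrite !muln_gt0 !fact_gt0 !expn_gt0 p_gt0.
by apply: (eq_cancel w_gt0 E); ring.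
Qed.

(** Doubling now carries into block [2 * k + 1], which leaves the extra factor [(2 * k + 1) * p]. *)
Lemma bin_double_block_carry k j : p <= 2 * j ->
  'C(2 * (k * p + j), k * p + j) * pfree_fact k j ^ 2 =
  (2 * k + 1) * 'C(2 * k, k) * p * pfree_fact (2 * k).+1 (2 * j - p).
Proof.
move=> le_p2j; have le_m m : m <= 2 * m by rewrite leq_pmull.
have := bin_fact (le_m (k * p + j)).
have -> m : 2 * m - m = m by lia.
have -> : 2 * (k * p + j) = (2 * k).+1 * p + (2 * j - p) by rewrite mulSn; lia.
rewrite !fact_block factS expnS.
have := bin_fact (le_m k); have -> m : 2 * m - m = m by lia.
move=> <-; have -> : p ^ (2 * k) = p ^ k * p ^ k by rewrite mul2n -addnn expnD.
set u := k`!; set P := p ^ k => E.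
have w_gt0 : 0 < u * u * P * P by rewrite !muln_gt0 !fact_gt0 !expn_gt0 p_gt0.
by apply: (eq_cancel w_gt0 E); ring.
Qed.

End BlockFactorial.

(** * Sums over 0 < j < p *)

Section HalvedSums.

Lemma big_nat_reflect (T : Type) (idx : T) (op : Monoid.com_law idx) (h : nat)
    (f : nat -> T) :
  \big[op/idx]_(1 <= j < h.*2.+1) f j =
  \big[op/idx]_(1 <= i < h.+1) op (f i) (f (h.*2.+1 - i)%N).
Proof.
rewrite (big_cat_nat (n := h.+1)) //=; last by lia.
rewrite big_split /=; congr (op _ _).
rewrite [RHS]big_nat_rev /= -{1}[h.+1]add1n big_addn.
have -> : (h.*2.+1 - h = h.+1)%N by lia.
by apply: eq_big_nat => i /andP[i_gt0 lt_ih]; congr f; lia.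
Qed.

Lemma sum_nat_parity (V : nmodType) (h : nat) (f : nat -> V) :
  \sum_(1 <= j < h.*2.+1) f j =
  \sum_(1 <= i < h.+1) (f (2 * i)%N + f (h.*2.+1 - 2 * i)%N).
Proof.
rewrite big_split /= [X in _ + X]big_nat_rev /=.
(* Reversed, the second sum runs over the odd numbers [2 * i - 1]; its terms no longer involve [h],
   so induction on [h] applies. *)
under [X in _ + X]eq_big_nat => i /andP[i_gt0 lt_ih].
  have -> : (h.*2.+1 - 2 * (1 + h.+1 - i.+1) = (2 * i).-1)%N by lia.
  over.
rewrite -big_split /=; elim: h => [|h IHh]; first by rewrite !big_geq.
rewrite doubleS [LHS]big_nat_recr //= [X in X + _]big_nat_recr //=.
rewrite [RHS]big_nat_recr //= IHh -!addrA.
congr (_ + _); rewrite addrC; congr (f _ + f _); lia.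
Qed.

End HalvedSums.

(** * Computations modulo p^4 *)

Section ModuloFourthPower.
Variables (R : comUnitRingType) (p : nat).
Hypotheses (p_pr : prime p) (p_ge5 : (5 <= p)%N).
Local Notation q := (p%:R : R).
Hypothesis q4 : q ^+ 4 = 0.

(** A Bezout relation between [d] and [p ^ 4] becomes an inverse of [d], because [p ^ 4] vanishes in
    [R]. *)
Lemma unit_natr d : coprime p d -> d%:R \is a @GRing.unit R.
Proof.
move=> co_pd; have d_gt0 : (0 < d)%N.
  by case: d co_pd => //; rewrite /coprime gcdn0; case: eqP p_ge5 => [->|].
have [a b Eab _] := egcdnP (p ^ 4) d_gt0.
have co_dp : coprime d (p ^ 4) by rewrite coprimeXr // coprime_sym.
apply/unitrPr; exists a%:R; rewrite -natrM mulnC Eab (eqP co_dp).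
by rewrite natrD natrM natrX q4 mulr0 add0r.
Qed.

Lemma unit_lt j : (0 < j < p)%N -> j%:R \is a @GRing.unit R.
Proof.
move=> /andP[j_gt0 lt_jp]; apply: unit_natr.
by rewrite prime_coprime // gtnNdvd.
Qed.

(* Congruence modulo p, seen through the multiplication by p ^ 3. *)
Definition eqp (x y : R) := q ^+ 3 * x = q ^+ 3 * y.

Lemma eqp_refl x : eqp x x. Proof. by []. Qed.

Lemma eqp_sym x y : eqp x y -> eqp y x. Proof. by []. Qed.

Lemma eqp_trans y x z : eqp x y -> eqp y z -> eqp x z.
Proof. by rewrite /eqp => ->. Qed.

Lemma eqpM x y x' y' : eqp x x' -> eqp y y' -> eqp (x * y) (x' * y').
Proof.
by rewrite /eqp => Ex Ey; rewrite mulrA Ex mulrAC Ey mulrAC mulrA.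
Qed.

Lemma eqpX x x' n : eqp x x' -> eqp (x ^+ n) (x' ^+ n).
Proof.
by move=> Ex; elim: n => [|n IHn]; rewrite ?exprS //; apply: eqpM.
Qed.

Lemma eqp_prod (I : Type) (r : seq I) (P : pred I) (f g : I -> R) :
  (forall i, P i -> eqp (f i) (g i)) ->
  eqp (\prod_(i <- r | P i) f i) (\prod_(i <- r | P i) g i).
Proof. by move=> Efg; apply: (big_ind2 eqp) => // *; apply: eqpM. Qed.

Lemma eqp_cancel u x y : u \is a GRing.unit -> eqp (u * x) (u * y) -> eqp x y.
Proof.
by rewrite /eqp => Uu; rewrite ![_ * (u * _)]mulrCA => /(mulrI Uu).
Qed.

Lemma eqp_addq x y : eqp (x + y * q) x.
Proof. by rewrite /eqp mulrDr mulrCA -exprSr q4 mulr0 addr0. Qed.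

Lemma eqp_modn a b : a = b %[mod p] -> eqp a%:R b%:R.
Proof.
have modp c : eqp c%:R (c %% p)%:R.
  by rewrite {1}(divn_eq c p) natrD natrM addrC; apply: eqp_addq.
by move=> Eab; apply: (eqp_trans (modp a)); rewrite Eab; apply/eqp_sym/modp.
Qed.

Lemma eqp_fermat j : coprime p j -> eqp (j%:R ^+ p.-1) 1.
Proof.
move=> co_pj; apply: (eqp_cancel (unit_natr co_pj)).
by rewrite -exprS prednK ?prime_gt0 // mulr1 -natrX; apply/eqp_modn/fermat_little.
Qed.

Definition half_harmonic e : R := \sum_(1 <= i < p./2.+1) (i%:R ^- e).

Lemma p_half : p = p./2.*2.+1.
Proof.
by case: (even_prime p_pr) => [p2|odd_p]; [move: p_ge5; rewrite p2 | lia].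
Qed.

Lemma sum_p_reflect (f : nat -> R) :
  \sum_(1 <= j < p) f j = \sum_(1 <= i < p./2.+1) (f i + f (p - i)%N).
Proof. by rewrite {1 3}p_half big_nat_reflect. Qed.

Lemma sum_p_parity (f : nat -> R) :
  \sum_(1 <= j < p) f j =
  \sum_(1 <= i < p./2.+1) (f (2 * i)%N + f (p - 2 * i)%N).
Proof. by rewrite {1 3}p_half sum_nat_parity. Qed.

(** The geometric series for [1 / (q - x)], and its square; the factor [q ^+ 2] kills everything
    beyond the term linear in [q]. *)
Lemma q2_inv_sub x X Y : X * x = 1 -> Y * (q - x) = 1 ->
  q ^+ 2 * Y = - q ^+ 2 * (X + q * X ^+ 2) /\
  q ^+ 2 * Y ^+ 2 = q ^+ 2 * (X ^+ 2 + 2 * q * X ^+ 3).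
Proof.
move=> EX EY.
have q2Y : q ^+ 2 * Y = - q ^+ 2 * (X + q * X ^+ 2).
  (* The bracket is the expansion of [(q - x) * (- X) * (1 + q * X)]. *)
  transitivity (q ^+ 2 * Y * (X * x - q ^+ 2 * X ^+ 2 + q * X * (X * x - 1))).
    by rewrite EX; ring: q4.
  transitivity (q ^+ 2 * (Y * (q - x)) * (- X) * (1 + q * X)); first by ring.
  by rewrite EY; ring.
split=> //; rewrite expr2 mulrA q2Y.
transitivity (- (X + q * X ^+ 2) * (q ^+ 2 * Y)); first by ring.
by rewrite q2Y; ring: q4.
Qed.

Lemma natr_inv_refl i : (0 < i < p)%N ->
  q ^+ 2 * (p - i)%:R^-1 = - q ^+ 2 * (i%:R^-1 + q * i%:R ^- 2) /\
  q ^+ 2 * (p - i)%:R ^- 2 = q ^+ 2 * (i%:R ^- 2 + 2 * q * i%:R ^- 3).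
Proof.
have odd_p := p_half.
move=> i_int; have U : (p - i)%:R \is a @GRing.unit R by apply: unit_lt; lia.
rewrite -!exprVn; apply: (@q2_inv_sub i%:R); first exact/mulVr/unit_lt.
by rewrite -natrB ?mulVr //; lia.
Qed.

Definition paired_harmonic : R :=
  \sum_(1 <= i < p./2.+1) (i%:R^-1 * (p - i)%:R^-1).

(** Write H2, H3 for the half harmonic sums. The two splittings of the sum of 1/j^2, multiplied by 8
    q^2 to clear the powers of 2, give 4 q^2 H2 + 2 q^3 H3 = 16 q^2 H2 + 16 q^3 H3. *)
Lemma half_harmonic2 :
  6 * (q ^+ 2 * half_harmonic 2) = - 7 * (q ^+ 3 * half_harmonic 3).
Proof.
have U2 : 2 \is a @GRing.unit R by apply: (@unit_lt 2); lia.
have := sum_p_reflect (fun j => j%:R ^- 2); rewrite sum_p_parity.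
have odd_p := p_half.
move=> /(congr1 (fun x => 8 * (q ^+ 2 * x))); rewrite !mulr_sumr.
under eq_big_nat => i i_int.
  have -> : 8 * (q ^+ 2 * ((2 * i)%:R ^- 2 + (p - 2 * i)%:R ^- 2)) =
      4 * q ^+ 2 * i%:R ^- 2 + 2 * q ^+ 3 * i%:R ^- 3.
    have [|_ E] := @natr_inv_refl (2 * i); first by lia.
    rewrite mulrDr {}E natrM -!exprVn invrM ?unit_lt //; try lia.
    have E2 : 2 * 2^-1 = 1 :> R by rewrite mulrV.
    transitivity (4 * q ^+ 2 * i%:R^-1 ^+ 2 * (2 * 2^-1) ^+ 2
       + 2 * q ^+ 3 * i%:R^-1 ^+ 3 * (2 * 2^-1) ^+ 3); last by rewrite E2; ring.
    by ring.
  over.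
under [in RHS]eq_big_nat => i i_int.
  have -> : 8 * (q ^+ 2 * (i%:R ^- 2 + (p - i)%:R ^- 2)) =
      16 * q ^+ 2 * i%:R ^- 2 + 16 * q ^+ 3 * i%:R ^- 3.
    have [|_ E] := @natr_inv_refl i; first by lia.
    by rewrite mulrDr {}E; ring.
  over.
rewrite !big_split -!mulr_sumr /= -!/(half_harmonic _) => E.
apply: (mulrI U2); apply/eqP; rewrite -subr_eq0; apply/eqP.
move/eqP: E; rewrite eq_sym -subr_eq0 => /eqP <-; ring.
Qed.

(** Expanding 1/(p-i) gives q^2 W = - q^2 H2 - q^3 H3; [half_harmonic2] then leaves 7 - 6 = 1 as the
    coefficient of q^3 H3. *)
Lemma paired_harmonicE :
  6 * (q ^+ 2 * paired_harmonic) = q ^+ 3 * half_harmonic 3.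
Proof.
have odd_p := p_half.
have -> : q ^+ 2 * paired_harmonic =
    - (q ^+ 2 * half_harmonic 2) - q ^+ 3 * half_harmonic 3.
  rewrite !mulr_sumr -!sumrN -big_split /=.
  apply: eq_big_nat => i i_int; have [|E _] := @natr_inv_refl i; first by lia.
  by rewrite mulrCA E -!exprVn; ring.
by rewrite mulrDr mulrN half_harmonic2; ring.
Qed.

(** * Bernoulli numbers and power sums *)

(* The p-integral rational x has image y in R. *)
Definition reduces (x : rat) (y : R) :=
  exists a : int, exists2 d : nat, coprime p d &
  x * d%:R = a%:~R /\ y * d%:R = a%:~R.

Lemma reduces_nat n : reduces n%:R n%:R.
Proof. by exists n, 1%N; rewrite ?coprimen1 // !mulr1. Qed.

Lemma reducesN x y : reduces x y -> reduces (- x) (- y).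
Proof.
by case=> a [d co_d [Ex Ey]]; exists (- a), d; rewrite // !mulNr Ex Ey !mulrNz.
Qed.

Lemma reducesD x y x' y' :
  reduces x y -> reduces x' y' -> reduces (x + x') (y + y').
Proof.
case=> a [d co_d [Ex Ey]] [a' [d' co_d' [Ex' Ey']]].
exists (a * d' + a' * d), (d * d')%N; first by rewrite coprimeMr co_d.
by rewrite !rmorphD !rmorphM /= -Ex -Ex' -Ey -Ey' ?natrM; split; ring.
Qed.

Lemma reducesM x y x' y' :
  reduces x y -> reduces x' y' -> reduces (x * x') (y * y').
Proof.
case=> a [d co_d [Ex Ey]] [a' [d' co_d' [Ex' Ey']]].
exists (a * a'), (d * d')%N; first by rewrite coprimeMr co_d.
by rewrite !rmorphM /= -Ex -Ex' -Ey -Ey' ?natrM; split; ring.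
Qed.

Lemma reducesV n : coprime p n -> reduces n%:R^-1 n%:R^-1.
Proof.
move=> co_pn; exists 1, n; first by [].
rewrite (mulVr (unit_natr co_pn)) mulVf // pnatr_eq0.
by apply: contraL co_pn => /eqP ->; rewrite /coprime gcdn0; case: eqP p_ge5 => [->|].
Qed.

Lemma reduces_sum (I : Type) (r : seq I) (P : pred I) (f : I -> rat) (g : I -> R) :
  (forall i, P i -> reduces (f i) (g i)) ->
  reduces (\sum_(i <- r | P i) f i) (\sum_(i <- r | P i) g i).
Proof.
move=> Efg; apply: (big_ind2 reduces) => //; first exact: (reduces_nat 0).
by move=> *; apply: reducesD.
Qed.

Lemma size_bern_list m : size (bern_list m) = m.+1.
Proof. by elim: m => //= m IHm; rewrite size_rcons IHm. Qed.

Lemma nth_bern_list m k : (k <= m)%N -> nth 0 (bern_list m) k = bernoulli k.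
Proof.
elim: m => [|m IHm]; first by case: k.
rewrite leq_eqVlt => /predU1P[-> //|lt_km].
by rewrite /= nth_rcons size_bern_list lt_km IHm.
Qed.

Lemma bernoulliS m : bernoulli m.+1 =
  - (m.+2%:R)^-1 * \sum_(k < m.+1) 'C(m.+2, k)%:R * bernoulli k.
Proof.
rewrite {1}/bernoulli /= nth_rcons size_bern_list ltnn eqxx; congr (_ * _).
by apply: eq_bigr => k _; rewrite nth_bern_list // -ltnS.
Qed.

(** The index 0 is included so that, with [0 ^+ 0 = 1], the sum for [m = 0] is [N]. *)
Definition power_sum N m : R := \sum_(0 <= j < N) j%:R ^+ m.

(** Telescoping of (j+1)^(m+1) - j^(m+1), each difference expanded by the binomial theorem. *)
Lemma power_sum_rec N m :
  \sum_(i < m.+1) 'C(m.+1, i)%:R * power_sum N i = N%:R ^+ m.+1.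
Proof.
have := telescope_sumr (fun j => j%:R ^+ m.+1 : R) (leq0n N).
rewrite expr0n subr0 => <-.
under eq_bigr do rewrite mulr_sumr; rewrite exchange_big /=.
apply: eq_bigr => j _; rewrite -natr1 exprD1n [in RHS]big_ord_recr /= binn.
by rewrite mulr1n addrK; apply: eq_bigr => i _; rewrite mulr_natl.
Qed.

(* Modulo p^2 the power sums satisfy, up to the factor p, the recurrence that
   defines the Bernoulli numbers. *)
Lemma power_sum_bernoulli m : (m < p.-1)%N ->
  exists beta : nat -> R, forall k, (k <= m)%N ->
    reduces (bernoulli k) (beta k) /\
    q ^+ 2 * power_sum p k = q ^+ 3 * beta k.
Proof.
elim: m => [_ | m IHm lt_mp].
  exists (fun=> 1) => k; rewrite leqn0 => /eqP ->.
  split; first exact: (reduces_nat 1).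
  by rewrite /power_sum sumr_const_nat subn0 mulr1 -exprSr.
have [|beta Ebeta] := IHm; first exact: ltnW.
have Um : m.+2%:R \is a @GRing.unit R by apply: unit_lt; lia.
(* The Bernoulli recurrence read in [R]; [m.+2 < p] makes the division possible. *)
pose b := - m.+2%:R^-1 * \sum_(k < m.+1) 'C(m.+2, k)%:R * beta k.
exists (fun k => if k == m.+1 then b else beta k) => k.
rewrite leq_eqVlt => /predU1P[->|lt_km]; last first.
  by rewrite ltn_eqF //; apply: Ebeta.
rewrite eqxx; split.
  rewrite bernoulliS; apply: reducesM.
    apply/reducesN/reducesV; rewrite prime_coprime // gtnNdvd //; lia.
  apply: reduces_sum => i _; apply: reducesM; first exact: reduces_nat.
  by case: (Ebeta i) => //; rewrite -ltnS.
apply: (mulrI Um); have := power_sum_rec p m.+1.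
move=> /(congr1 (fun x => q ^+ 2 * x)); rewrite big_ord_recr /= binSn.
(* After multiplication by [q ^+ 2] the right side of the recurrence is a multiple of [q ^+ 4],
   hence zero, and the top power sum is determined by the lower ones. *)
rewrite -exprD (_ : (2 + m.+2 = 4 + m)%N) // exprD q4 mul0r mulrDr.
rewrite mulrCA => /eqP; rewrite addrC addr_eq0 => /eqP ->.
transitivity (- (m.+2%:R * m.+2%:R^-1 * (q ^+ 3 *
    \sum_(k < m.+1) 'C(m.+2, k)%:R * beta k))); last by rewrite /b; ring.
rewrite mulrV // mul1r; congr (- _).
rewrite !mulr_sumr; apply: eq_bigr => i _.
by have [|_ E] := Ebeta i; [rewrite -ltnS | rewrite mulrCA E mulrCA].
Qed.

Lemma q2_exprD x m :
  q ^+ 2 * (x + q) ^+ m.+1 = q ^+ 2 * (x ^+ m.+1 + m.+1%:R * q * x ^+ m).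
Proof.
elim: m => [|m IHm]; first by rewrite !expr1 expr0; ring.
rewrite exprS mulrCA IHm [x ^+ m.+2]exprS [x ^+ m.+1]exprS.
by rewrite -[m.+2]addn1 natrD; move: (x ^+ m) => X; ring: q4.
Qed.

(** The two splittings of the sum of j^(p-3) give two relations between b, A and C; A is eliminated.
    By Fermat, modulo p, C is the sum of 1/i^3 and 8 * 2^(p-4) = 1, while p - 3 = -3; the result is
    3 C = 2 b - 8 b. *)
Lemma half_harmonic3_bernoulli :
  exists2 b, reduces (bernoulli (p - 3)) b &
  q ^+ 3 * half_harmonic 3 = - 2 * (q ^+ 3 * b).
Proof.
have odd_p := p_half.
have [|beta /(_ (p - 3)%N (leqnn _)) [Hb Eb]] := @power_sum_bernoulli (p - 3).
  lia.
exists (beta (p - 3)%N) => //; move: (beta _) => b in Hb Eb *.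
(* The exponent [m.+1] is even and [m] odd, which fixes the signs in the expansion of
   (p-j)^(m+1). *)
pose m := (p - 4)%N; have Em : (p - 3 = m.+1)%N by lia.
have odd_m : odd m by rewrite /m odd_p; lia.
rewrite {}Em in Eb {Hb}.
pose A : R := \sum_(1 <= i < p./2.+1) i%:R ^+ m.+1.
pose C : R := \sum_(1 <= i < p./2.+1) i%:R ^+ m.
have E_refl (j : nat) : (j <= p)%N -> q ^+ 2 * (p - j)%:R ^+ m.+1 =
    q ^+ 2 * (j%:R ^+ m.+1 - m.+1%:R * q * j%:R ^+ m).
  move=> le_jp; rewrite natrB // addrC q2_exprD.
  rewrite (exprNn j%:R m.+1) (exprNn j%:R m) -(signr_odd _ m.+1) -(signr_odd _ m).
  by rewrite /= odd_m /= expr1; ring.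
have T1 : power_sum p m.+1 = \sum_(1 <= j < p) j%:R ^+ m.+1.
  by rewrite /power_sum big_ltn ?prime_gt0 // expr0n add0r.
have ET1 : q ^+ 3 * b = 2 * (q ^+ 2 * A) - m.+1%:R * (q ^+ 3 * C).
  rewrite -Eb T1 sum_p_reflect !mulr_sumr -sumrB.
  apply: eq_big_nat => i i_int; rewrite mulrDr E_refl; last by lia.
  ring.
have ET2 : q ^+ 3 * b =
    2 * 2 ^+ m.+1 * (q ^+ 2 * A) - m.+1%:R * 2 ^+ m * (q ^+ 3 * C).
  rewrite -Eb T1 sum_p_parity !mulr_sumr -sumrB.
  apply: eq_big_nat => i i_int; rewrite mulrDr E_refl; last by lia.
  by rewrite natrM !exprMn !(exprS _ m); ring.
have F2 : q ^+ 3 * (8 * 2 ^+ m) = q ^+ 3.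
  have co2 : coprime p 2 by rewrite prime_coprime // gtnNdvd //; lia.
  have := eqp_fermat co2; rewrite /eqp mulr1 => E; rewrite -[RHS]E.
  have -> : p.-1 = (3 + m)%N by rewrite /m; lia.
  by rewrite exprD; ring.
have Em3 : q ^+ 3 * m.+1%:R = - 3 * q ^+ 3.
  have -> : m.+1%:R = q - 3 by rewrite -natrB; [congr _%:R; lia | lia].
  by ring: q4.
have EC : q ^+ 3 * half_harmonic 3 = q ^+ 3 * C.
  rewrite !mulr_sumr; apply: eq_big_nat => i i_int.
  have i_lt : (0 < i < p)%N by lia.
  have co_i : coprime p i by rewrite prime_coprime // gtnNdvd //; lia.
  apply: (eqp_cancel (unitrX 3 (unit_lt i_lt))).
  rewrite mulrV ?unitrX ?unit_lt //; apply/eqp_sym.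
  rewrite -exprD (_ : (3 + m = p.-1)%N); first exact: eqp_fermat.
  by rewrite /m; lia.
have U3 : 3 \is a @GRing.unit R by apply: (@unit_lt 3); lia.
rewrite EC; apply: (mulrI U3).
(* [A] is eliminated: [2 ^+ m.+1] times [ET1] minus [ET2], scaled by 8 to bring in [F2]. *)
have E : 8 * (2 * 2 ^+ m - 1) * (q ^+ 3 * b) =
    - (8 * 2 ^+ m * m.+1%:R * (q ^+ 3 * C)).
  transitivity (8 * (2 * 2 ^+ m * (q ^+ 3 * b) - q ^+ 3 * b)); first by ring.
  by rewrite {1}ET1 ET2 (exprS 2 m); ring.
transitivity (- (q ^+ 3 * m.+1%:R) * C); first by rewrite Em3; ring.
transitivity (- (q ^+ 3 * (8 * 2 ^+ m)) * m.+1%:R * C); first by rewrite F2; ring.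
transitivity (- (8 * 2 ^+ m * m.+1%:R * (q ^+ 3 * C))); first by ring.
rewrite -E; transitivity (2 * (q ^+ 3 * (8 * 2 ^+ m)) * b - 8 * q ^+ 3 * b).
  by ring.
by rewrite F2; ring.
Qed.

(** * Binomial coefficients modulo p^4 *)

Local Notation w := ((p.-1)`!%:R : R).

Lemma eqp_pfree_fact a b : eqp (pfree_fact p a b)%:R (w ^+ a * b`!%:R).
Proof.
have E c (i : nat) : eqp (c * p + i)%:R i%:R.
  by rewrite natrD natrM addrC; apply: eqp_addq.
rewrite /pfree_fact natrM !natr_prod.
apply: eqpM; last by rewrite fact_prod natr_prod; apply: eqp_prod => i _; apply: E.
have -> : w ^+ a = \prod_(i < a) w by rewrite prodr_const card_ord.
apply: eqp_prod => i _.
rewrite /block fact_prod prednK ?prime_gt0 // !natr_prod.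
by apply: eqp_prod => j _; apply: E.
Qed.

(** Passing from [i] to [i.+1] trades the factor [p - i.+1] for [i.+1], which is its negative modulo
    [p]. *)
Lemma eqp_factN i : (i < p)%N -> eqp (i`! * (p - i.+1)`!)%:R ((-1) ^+ i * w).
Proof.
elim: i => [|i IHi] lt_ip; first by rewrite fact0 mul1n subn1 expr0 mul1r.
have E : (p - i.+1 = (p - i.+2).+1)%N by lia.
have Ui : (p - i.+1)%:R \is a @GRing.unit R by apply: unit_lt; lia.
apply: (eqp_cancel Ui); rewrite -natrM.
have -> : ((p - i.+1) * (i.+1`! * (p - i.+2)`!) =
    i.+1 * (i`! * (p - i.+1)`!))%N by rewrite E !factS; ring.
rewrite natrM; apply: (eqp_trans (eqpM (eqp_refl _) (IHi (ltnW lt_ip)))).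
rewrite natrB; last by lia.
by rewrite (exprS (-1) i) /eqp; move: ((-1) ^+ i) => s; ring: q4.
Qed.

Lemma eqp_fact_refl j : (0 < j < p)%N ->
  eqp (j`! * (p - j)`!)%:R (- (-1) ^+ j * (j%:R * w)).
Proof.
case: j => // j /andP[_ lt_jp]; rewrite factS -mulnA natrM.
apply: (eqp_trans (eqpM (eqp_refl _) (eqp_factN (ltnW lt_jp)))).
by rewrite /eqp (exprS (-1) j); move: ((-1) ^+ j) => s; ring.
Qed.

(** Division-free form of: the p-free part of an off-block term for (r,s) = (2,1) is -2/j^3 modulo
    p, up to small binomial factors. With [w] the factorial of p-1, (2j)!(p-2j)! yields -2jw, the
    fourth power of j!(p-j)! yields (jw)^4, and the powers of [w] agree. *)
Lemma offblock_coprime_part k N j : (0 < j <= p./2)%N ->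
  q ^+ 3 * (pfree_fact p (k + N.+1) 0 ^ 2 * pfree_fact p (2 * k) (2 * j) *
     pfree_fact p (2 * N).+1 (p - 2 * j))%:R * j%:R ^+ 3 =
  - 2 * q ^+ 3 * (pfree_fact p k j * pfree_fact p N (p - j))%:R ^+ 4.
Proof.
move=> j_int; have odd_p := p_half.
have Ej : eqp (j`! * (p - j)`!)%:R (- (-1) ^+ j * (j%:R * w)).
  by apply: eqp_fact_refl; lia.
have E2j : eqp ((2 * j)`! * (p - 2 * j)`!)%:R (- (2 * j%:R * w)).
  apply: (eqp_trans (eqp_fact_refl _)); first by lia.
  by rewrite -signr_odd oddM /= expr0 natrM mulN1r.
have EL : eqp ((pfree_fact p (k + N.+1) 0 ^ 2 * pfree_fact p (2 * k) (2 * j) *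
     pfree_fact p (2 * N).+1 (p - 2 * j))%:R * j%:R ^+ 3)
   (w ^+ (4 * (k + N).+1) * (- 2 * j%:R ^+ 4)).
  rewrite 2!natrM natrX expr2.
  apply: (eqp_trans (eqpM (eqpM (eqpM (eqpM (eqp_pfree_fact _ _) (eqp_pfree_fact _ _))

     (eqp_pfree_fact _ _)) (eqp_pfree_fact _ _)) (eqp_refl _))).
  have -> : w ^+ (k + N.+1) * 0`!%:R * (w ^+ (k + N.+1) * 0`!%:R) * (w ^+ (2 * k) * (2 * j)`!%:R) *
     (w ^+ (2 * N).+1 * (p - 2 * j)`!%:R) * j%:R ^+ 3 =
     w ^+ (4 * k + 4 * N + 3) * ((2 * j)`! * (p - 2 * j)`!)%:R * j%:R ^+ 3.
    have -> : w ^+ (4 * k + 4 * N + 3) =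
        w ^+ (k + N.+1) ^+ 2 * w ^+ (2 * k) * w ^+ (2 * N).+1.
      by rewrite -exprM -!exprD; congr (_ ^+ _); lia.
    by rewrite natrM fact0; move: (w ^+ _) (w ^+ _) (w ^+ _) => x y z; ring.
  apply: (eqp_trans (eqpM (eqpM (eqp_refl _) E2j) (eqp_refl _))).
  rewrite (_ : 4 * (k + N).+1 = (4 * k + 4 * N + 3).+1)%N; last by lia.
  by rewrite /eqp (exprS w); move: (w ^+ _) => x; ring.
have ER : eqp ((pfree_fact p k j * pfree_fact p N (p - j))%:R ^+ 4)
    (w ^+ (4 * (k + N).+1) * j%:R ^+ 4).
  rewrite natrM; apply: (eqp_trans (eqpX 4 (eqpM (eqp_pfree_fact _ _)
     (eqp_pfree_fact _ _)))).
  have -> : (w ^+ k * j`!%:R * (w ^+ N * (p - j)`!%:R)) ^+ 4 =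
     w ^+ (4 * (k + N)) * (j`! * (p - j)`!)%:R ^+ 4.
    rewrite natrM [(4 * _)%N]mulnC exprM exprD.
    by move: (w ^+ _) (w ^+ _) => x y; ring.
  apply: (eqp_trans (eqpM (eqp_refl _) (eqpX 4 Ej))).
  have s2 : ((-1) ^+ j) ^+ 2 = 1 :> R by rewrite sqrr_sign.
  rewrite mulnSr exprD /eqp.
  by move: (w ^+ (4 * _)) s2 => x; move: (_ ^+ j) => s s2; ring: s2.
rewrite -mulrA -[in RHS]mulrA EL ER; ring.
Qed.
Local Notation theta := (q ^+ 2 * paired_harmonic).

Lemma prod_addr_sq0 (e : R) (d : nat -> R) m n : e ^+ 2 = 0 ->
  (forall i, (m <= i < n)%N -> d i \is a GRing.unit) ->
  \prod_(m <= i < n) (d i + e) =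
  \prod_(m <= i < n) d i * (1 + e * \sum_(m <= i < n) (d i)^-1).
Proof.
move=> e2 Ud; have [le_nm | /ltnW le_mn] := leqP n m.
  by rewrite !big_geq // mulr0 addr0 mulr1.
elim: n le_mn Ud => [|n IHn].
  by rewrite leqn0 => /eqP -> _; rewrite !big_geq // mulr0 addr0 mulr1.
rewrite leq_eqVlt => /predU1P[-> _|]; first by rewrite !big_geq // mulr0 addr0 mulr1.
rewrite ltnS => le_mn Ud.
rewrite !big_nat_recr //= IHn //; last by move=> i i_int; apply: Ud; lia.
have := mulVr (Ud n _); rewrite le_mn ltnSn => /(_ isT).
move: (d n) (_^-1) => x X EX; set P := \prod_(m <= i < n) _; set S := \sum_(m <= i < n) _.
(* The new factor is split as x + e = x (1 + e X) + e (1 - X x), whose last term vanishes. *)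
transitivity (P * (1 + e * S) * x * (1 + e * X) + P * (1 + e * S) * e * (1 - X * x)).
  ring.
by rewrite EX; ring: e2.
Qed.

(** This is [block p 0], the factorial of p-1, with its factors grouped in pairs. *)
Definition paired_prod : R := \prod_(1 <= j < p./2.+1) (j%:R * (p - j)%:R).

Lemma unit_paired j : (1 <= j < p./2.+1)%N ->
  j%:R * (p - j)%:R \is a @GRing.unit R.
Proof. by move=> j_int; have odd_p := p_half; rewrite unitrM !unit_lt //; lia. Qed.

Lemma unit_paired_prod : paired_prod \is a GRing.unit.
Proof.
rewrite /paired_prod big_nat_cond.
by apply: rpred_prod => j; rewrite andbT; apply: unit_paired.
Qed.

(** Each pair satisfies (ip+j)(ip+p-j) = j(p-j) + i(i+1)p^2, and the perturbation squares to
    zero. *)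
Lemma natr_block i :
  (block p i)%:R = paired_prod * (1 + (i * i.+1)%:R * theta).
Proof.
have odd_p := p_half; rewrite /block natr_prod {1}odd_p big_nat_reflect -odd_p.
pose e : R := (i * i.+1)%:R * q ^+ 2.
have e2 : e ^+ 2 = 0 by rewrite /e; ring: q4.
transitivity (\prod_(1 <= j < p./2.+1) (j%:R * (p - j)%:R + e)).
  apply: eq_big_nat => j j_int; rewrite natrB; last by lia.
  by rewrite /e !natrD !natrM -natr1 natrB /=; [ring | lia].
rewrite prod_addr_sq0 //; last exact: unit_paired.
congr (_ * (1 + _)); rewrite -mulrA; congr (_ * (_ * _)).
by apply: eq_big_nat => j j_int; rewrite invrM ?unit_lt // 1?mulrC //; lia.
Qed.

(** By [paired_harmonicE], 6 theta is a multiple of q^3, and 6 is a unit because p is at least 5. *)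
Lemma theta_q : theta * q = 0.
Proof.
have U6 : 6 \is a @GRing.unit R.
  rewrite (_ : 6 = 2 * 3) ?unitrM ?(@unit_lt 2) ?(@unit_lt 3) //; first by lia.
  by lia.
  by ring.
by apply: (mulrI U6); rewrite mulrA paired_harmonicE; ring: q4.
Qed.

Lemma theta2 : theta ^+ 2 = 0.
Proof. by rewrite expr2 [in X in _ * X]exprS !mulrA theta_q !mul0r. Qed.

Lemma theta_bernoulli :
  exists2 b, reduces (bernoulli (p - 3)) b &
    3 * theta = - (q ^+ 3 * b) /\
    q ^+ 3 * half_harmonic 3 = - 2 * (q ^+ 3 * b).
Proof.
have [b Hb Eb] := half_harmonic3_bernoulli; exists b => //; split=> //.
have U2 : 2 \is a @GRing.unit R by apply: (@unit_lt 2); lia.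
apply: (mulrI U2); transitivity (6 * theta); first by ring.
by rewrite paired_harmonicE Eb; ring.
Qed.

Definition pronic_sum a := (\sum_(i < a) i * i.+1)%N.

Lemma pronic_sumE a : (3 * pronic_sum a + a = a ^ 3)%N.
Proof.
elim: a => [|a IHa]; first by rewrite /pronic_sum big_ord0.
by rewrite /pronic_sum big_ord_recr /= -/(pronic_sum a); nia.
Qed.

(** Since [pronic_sum a] is (a^3 - a)/3, the defect of additivity is ((k+l)^3 - k^3 - l^3)/3. It
    becomes the coefficient nk(n-k) in [bin_mulp]. *)
Lemma pronic_sumD k l :
  (pronic_sum (k + l) = pronic_sum k + pronic_sum l + (k + l) * k * l)%N.
Proof.
by have := (pronic_sumE k, pronic_sumE l, pronic_sumE (k + l)) => -[[]]; nia.
Qed.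

Lemma natr_pfree_fact0 a :
  (pfree_fact p a 0)%:R = paired_prod ^+ a * (1 + (pronic_sum a)%:R * theta).
Proof.
rewrite pfree_fact0 /pronic_sum.
elim: a => [|a IHa]; first by rewrite !big_ord0 expr0; ring.
rewrite !big_ord_recr /= natrM {}IHa natr_block (exprS _ a) natrD.
move: (\sum_(i < a) _)%N => s; move: (theta) theta2 => t t2.
move: (paired_prod ^+ a) => x.
by ring: t2.
Qed.

Lemma bin_mulp k l :
  'C((k + l) * p, k * p)%:R =
  'C(k + l, k)%:R * (1 + ((k + l) * k * l)%:R * theta) :> R.
Proof.
have : 'C((k + l) * p, k * p)%:R *
    ((pfree_fact p k 0)%:R * (pfree_fact p l 0)%:R) =
    'C(k + l, k)%:R * (pfree_fact p (k + l) 0)%:R :> R.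
  rewrite -!natrM; congr _%:R.
  by have := bin_block (prime_gt0 p_pr) (leq_addr l k); rewrite addKn.
rewrite !natr_pfree_fact0.
rewrite pronic_sumD 2!natrD !natrM exprD.
move: (theta) theta2 (pronic_sum k)%:R (pronic_sum l)%:R => t t2 sk sl E.
have U : paired_prod ^+ k * paired_prod ^+ l \is a GRing.unit.
  by rewrite unitrM !unitrX ?unit_paired_prod.
apply: (mulrI U); move: (paired_prod ^+ k) (paired_prod ^+ l) E {U} => x y E.
set c : R := 'C(_ * p, _)%:R in E *.
(* As t^2 = 0, the last factor is the inverse of (1 + sk t)(1 + sl t). *)
transitivity (c * (x * (1 + sk * t) * (y * (1 + sl * t))) * (1 - (sk + sl) * t)).
  by ring: t2.
by rewrite E natrD; ring: t2.
Qed.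

Lemma unit_pfree_fact a b : (b < p)%N -> (pfree_fact p a b)%:R \is a @GRing.unit R.
Proof.
move=> lt_bp; have U c i : (0 < i < p)%N -> (c * p + i)%:R \is a @GRing.unit R.
  move=> i_int; apply: unit_natr.
  by rewrite prime_coprime // dvdn_addr ?dvdn_mull // gtnNdvd //; lia.
rewrite /pfree_fact /block natrM !natr_prod unitrM; apply/andP; split.
  apply: rpred_prod => i _; rewrite natr_prod big_nat_cond.
  by apply: rpred_prod => j; rewrite andbT; apply: U.
by rewrite big_nat_cond; apply: rpred_prod => j j_int; apply: U; lia.
Qed.

(** * Terms whose index is not a multiple of p *)

Definition summand r s n m : nat :=
  ('C(n, m) ^ r * ('C(2 * m, m) * 'C(2 * n - 2 * m, n - m)) ^ s)%N.

Lemma summand_sub r s n m : (m <= n)%N -> summand r s n (n - m) = summand r s n m.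
Proof.
move=> le_mn; rewrite /summand bin_sub // subKn // -!mulnBr subKn //.
by rewrite mulnBr [('C(2 * m, m) * _)%N]mulnC.
Qed.

Section OffBlockTerm.
Variables k N j : nat.
Hypothesis j_int : (0 < j <= p./2)%N.
Local Notation n := (k + N.+1)%N.
Local Notation m := (k * p + j)%N.
Local Notation u := ((pfree_fact p k j)%:R : R).
Local Notation v := ((pfree_fact p N (p - j))%:R : R).

Lemma offblock_sub : (n * p - m = N * p + (p - j))%N.
Proof. by have odd_p := p_half; rewrite mulnDl mulSn; lia. Qed.

Lemma unit_offblock : u * v \is a GRing.unit.
Proof. by have odd_p := p_half; rewrite unitrM !unit_pfree_fact //; lia. Qed.

Lemma bin_offblock_ring :
  'C(n * p, m)%:R * (u * v) =
  n%:R * 'C(k + N, k)%:R * q * (pfree_fact p n 0)%:R.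
Proof.
have odd_p := p_half; rewrite -!natrM; congr _%:R.
by apply: bin_offblock; lia.
Qed.

Lemma bin_double_ring :
  'C(2 * m, m)%:R * u ^+ 2 =
  'C(2 * k, k)%:R * (pfree_fact p (2 * k) (2 * j))%:R.
Proof.
rewrite -natrX -!natrM; congr _%:R.
by apply: bin_double_block; apply: prime_gt0.
Qed.

(** With j at most p/2, doubling kp+j causes no carry, but the complementary residue p-j exceeds
    p/2: this central binomial coefficient carries and is divisible by p. *)
Lemma bin_double_carry_ring :
  'C(2 * (n * p) - 2 * m, n * p - m)%:R * v ^+ 2 =
  (2 * N + 1)%:R * 'C(2 * N, N)%:R * q * (pfree_fact p (2 * N).+1 (p - 2 * j))%:R.
Proof.
have odd_p := p_half; rewrite -mulnBr offblock_sub -natrX -!natrM; congr _%:R.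
rewrite bin_double_block_carry ?prime_gt0 //; last by lia.
by congr (_ * pfree_fact _ _ _)%N; lia.
Qed.

Lemma summand_offblock_eq0 r s : (0 < s)%N -> (4 <= r + s)%N ->
  (summand r s (n * p) m)%:R = 0 :> R.
Proof.
move=> s_gt0 le4rs; have U := unit_offblock; have := U; rewrite unitrM => /andP[_ Uv].
have [c1 E1] : exists c, 'C(n * p, m)%:R = q * c :> R.
  (* The witness, fixed by unification, is the right side without [q], divided by the unit
     [u * v]. *)
  eexists; apply: (mulIr U); rewrite bin_offblock_ring.
  rewrite mulrAC -[RHS]mulrA [q * _]mulrC; congr (_ * _).
  by rewrite -[LHS](mulrVK U).
have [c2 E2] : exists c, 'C(2 * (n * p) - 2 * m, n * p - m)%:R = q * c :> R.
  eexists; apply: (mulIr (unitrX 2 Uv)); rewrite bin_double_carry_ring.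
  rewrite mulrAC -[RHS]mulrA [q * _]mulrC; congr (_ * _).
  by rewrite -[LHS](mulrVK (unitrX 2 Uv)).
rewrite /summand natrM !natrX natrM E1 E2 [X in _ * X ^+ s]mulrCA 2!exprMn.
rewrite mulrACA -exprD -(subnK le4rs) exprD q4; ring.
Qed.

(** The squared binomial coefficient gives q^2 and the carrying central one gives q. Clearing the
    denominators (uv)^4 and j^3 reduces the claim to [offblock_coprime_part]. *)
Lemma summand_offblock21 :
  (summand 2 1 (n * p) m)%:R =
  - 2 * q ^+ 3 * (n ^ 2 * 'C(k + N, k) ^ 2 * 'C(2 * k, k) * 'C(2 * N, N)
                  * (2 * N + 1))%:R * j%:R ^- 3 :> R.
Proof.
have odd_p := p_half; have U := unit_offblock.
have Uj : j%:R \is a @GRing.unit R by apply: unit_lt; lia.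
have E := offblock_coprime_part k N j_int.
have E1 := bin_offblock_ring; have E2 := bin_double_ring.
have E3 := bin_double_carry_ring.
rewrite 2!natrM natrX [(pfree_fact _ k j * _)%:R]natrM in E.
have -> : (n ^ 2 * 'C(k + N, k) ^ 2 * 'C(2 * k, k) * 'C(2 * N, N) * (2 * N + 1))%:R
    = (n%:R * 'C(k + N, k)%:R) ^+ 2 * 'C(2 * k, k)%:R *
      ((2 * N + 1)%:R * 'C(2 * N, N)%:R) :> R.
  by rewrite !natrM; ring.
rewrite /summand expn1 natrM natrX natrM.
apply: (mulIr (unitrX 4 U)); apply: (mulIr (unitrX 3 Uj)).
move: (n%:R * _) ((2 * N + 1)%:R * _) 'C(2 * k, k)%:R E1 E2 E3 => a d b.
move: 'C(_, _)%:R 'C(_, _)%:R 'C(_, _)%:R => c1 c2 c3 E1 E2 E3.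
have EJ := mulVr (unitrX 3 Uj).
move: E E1 E2 E3 {U}; move: u v (pfree_fact p n 0)%:R (pfree_fact p (2 * k) _)%:R
  (pfree_fact p _.+1 _)%:R => x y f1 f2 f3.
move=> E E1 E2 E3.
transitivity ((c3 * (x * y)) ^+ 2 * (c2 * x ^+ 2) * (c1 * y ^+ 2) * j%:R ^+ 3).
  by ring.
rewrite E1 E2 E3.
transitivity (a ^+ 2 * b * d * (q ^+ 3 * (f1 ^+ 2 * f2 * f3) * j%:R ^+ 3)).
  by ring.
rewrite E.
transitivity (- 2 * q ^+ 3 * (a ^+ 2 * b * d) * (x * y) ^+ 4 *
  (j%:R ^- 3 * j%:R ^+ 3)); last by ring.
by rewrite EJ; ring.
Qed.

End OffBlockTerm.

(** An index kp + (p-j) in the upper half of a block is sent by m -> np - m to (n-k-1)p + j, so only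
    residues j up to p/2 remain. *)
Lemma sum_offblocks r s n :
  \sum_(m < (n * p).+1) (summand r s (n * p) m)%:R =
  \sum_(k < n.+1) (summand r s (n * p) (k * p))%:R +
  \sum_(k < n) \sum_(1 <= j < p./2.+1)
    ((summand r s (n * p) (k * p + j))%:R +
     (summand r s (n * p) ((n - k.+1) * p + j))%:R) :> R.
Proof.
have odd_p := p_half; rewrite !big_ord_recr /= addrAC; congr (_ + _).
rewrite -(big_mkord xpredT (fun m => (summand r s (n * p) m)%:R : R)) big_nat_mul.
rewrite big_mkord -big_split /=; apply: eq_bigr => k _.
rewrite -{1}[(k * p)%N]add0n big_addn mulSn addnK.
rewrite big_ltn ?prime_gt0 // add0n; congr (_ + _); rewrite sum_p_reflect.
apply: eq_big_nat => j j_int; rewrite addnC; congr (_ + _%:R).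
have lt_kn := ltn_ord k.
have Ek : (n * p = k * p + p + (n - k.+1) * p)%N.
  by rewrite -{1}(subnKC lt_kn) mulnDl mulSn; lia.
rewrite -summand_sub; last by lia.
congr summand; move: (n * p)%N (k * p)%N ((n - k.+1) * p)%N Ek => x y z; lia.
Qed.

(** [bin_mulp] is applied to three binomial coefficients; in the central ones its coefficient is
    (i+i) * i * i = 2 i^3. As theta^2 = 0, exponents and coefficients add up linearly. *)
Lemma summand_block r s k l :
  (summand r s ((k + l) * p) (k * p))%:R =
  (summand r s (k + l) k)%:R *
  (1 + (r * (k + l) * k * l + 2 * s * k ^ 3 + 2 * s * l ^ 3)%:R * theta) :> R.
Proof.
have pow1 (x : R) e : (1 + x * theta) ^+ e = 1 + e%:R * x * theta.
  elim: e => [|e IHe]; first by rewrite expr0; ring.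
  rewrite exprS IHe -natr1; move: (theta) theta2 => t t2; ring: t2.
have double i : 'C(2 * (i * p), i * p)%:R =
    'C(2 * i, i)%:R * (1 + (2 * i ^ 3)%:R * theta) :> R.
  have -> : (2 * (i * p) = (i + i) * p)%N by ring.
  rewrite bin_mulp (_ : i + i = 2 * i)%N; last by ring.
  by congr (_ * (1 + _%:R * _)); ring.
rewrite /summand -!mulnBr -!mulnBl addKn !natrM !natrX !natrM bin_mulp !double.
rewrite !exprMn !pow1; move: (theta) theta2 => t t2.
by rewrite !natrD !natrM; ring: t2.
Qed.

(** * The sum over all indices *)

Definition calD_ring r s n : R :=
  if (r == 2%N) && (s == 1%N) then
    8 * (\sum_(k < n)
       ('C(n, k) ^ 2 * 'C(2 * k, k) * 'C(2 * n - 2 * k - 2, n - k - 1)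
          * n * (n - k) ^ 2)%N%:R)
    - 3^-1 * (\sum_(k < n.+1)
       ('C(n, k) ^ 2 * 'C(2 * k, k) * 'C(2 * n - 2 * k, n - k)
          * (2 * n * k * (n - k) + 2 * k ^ 3 + 2 * (n - k) ^ 3))%N%:R)
  else
    - 3^-1 * (\sum_(k < n.+1)
       ('C(n, k) ^ r * ('C(2 * k, k) * 'C(2 * n - 2 * k, n - k)) ^ s
          * (r * n * k * (n - k) + 2 * s * k ^ 3 + 2 * s * (n - k) ^ 3))%N%:R).

Lemma reduces_calD r s n : reduces (calD r s n) (calD_ring r s n).
Proof.
have reduces3 : reduces 3^-1 3^-1.
  by apply: (@reducesV 3); rewrite prime_coprime // gtnNdvd //; lia.
rewrite /calD /calD_ring; case: ifP => _.
  apply: reducesD; first apply: (reducesM (reduces_nat 8)).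
    by apply: reduces_sum => k _; apply: reduces_nat.
  apply/reducesN/(reducesM reduces3).
  by apply: reduces_sum => k _; apply: reduces_nat.
apply: (reducesM (reducesN reduces3)).
by apply: reduces_sum => k _; apply: reduces_nat.
Qed.

Lemma sum_multiples r s n b : 3 * theta = - (q ^+ 3 * b) ->
  \sum_(k < n.+1) (summand r s (n * p) (k * p))%:R =
  \sum_(k < n.+1) (summand r s n k)%:R +
  q ^+ 3 * b * (- 3^-1 * (\sum_(k < n.+1)
       ('C(n, k) ^ r * ('C(2 * k, k) * 'C(2 * n - 2 * k, n - k)) ^ s
          * (r * n * k * (n - k) + 2 * s * k ^ 3 + 2 * s * (n - k) ^ 3))%N%:R)) :> R.
Proof.
move=> Etheta; have U3 : 3 \is a @GRing.unit R by apply: (@unit_lt 3); lia.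
have -> : q ^+ 3 * b = - (3 * theta) by rewrite Etheta opprK.
set S := \sum_(k < n.+1) (_ * _)%N%:R.
have -> : - (3 * theta) * (- 3^-1 * S) = theta * S.
  transitivity (3 * 3^-1 * (theta * S)); first by ring.
  by rewrite mulrV // mul1r.
rewrite mulr_sumr -big_split /=.
apply: eq_bigr => k _; have le_kn : (k <= n)%N by rewrite -ltnS.
have := summand_block r s k (n - k); rewrite subnKC // => ->.
by rewrite -/(summand r s n k) natrM; move: (theta) => t; ring.
Qed.

(** The blocks k and N = n-k-1 share the symmetric factor [Y], and (2N+1) + (2k+1) = 2n. With the -2
    of each term this gives -4nY/j^3, and the sum over j contributes another -2b. Finally n C(n-1,k)
    = (n-k) C(n,k). *)
Lemma sum_nonmultiples21 n b :
  q ^+ 3 * half_harmonic 3 = - 2 * (q ^+ 3 * b) ->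
  \sum_(k < n) \sum_(1 <= j < p./2.+1)
    ((summand 2 1 (n * p) (k * p + j))%:R +
     (summand 2 1 (n * p) ((n - k.+1) * p + j))%:R) =
  q ^+ 3 * b * (8 * (\sum_(k < n)
       ('C(n, k) ^ 2 * 'C(2 * k, k) * 'C(2 * n - 2 * k - 2, n - k - 1)
          * n * (n - k) ^ 2)%N%:R)).
Proof.
move=> Eh; rewrite !mulr_sumr; apply: eq_bigr => k _; have lt_kn := ltn_ord k.
have -> : (2 * n - 2 * k - 2 = 2 * (n - k.+1))%N by lia.
have -> : (n - k - 1 = n - k.+1)%N by lia.
set N := (n - k.+1)%N; have En : n = (k + N.+1)%N by lia.
have En' : n = (N + k.+1)%N by lia.
have bin_n : ((n - k) * 'C(n, k) = n * 'C(k + N, k))%N.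
  by rewrite -mul_bin_down; congr (_ * 'C(_, _))%N; lia.
have bin_N : 'C(N + k, N) = 'C(k + N, k).
  by rewrite addnC -(bin_sub (leq_addl k N)) addnK.
pose Y := (n ^ 2 * 'C(k + N, k) ^ 2 * ('C(2 * k, k) * 'C(2 * N, N)))%N.
have -> : ('C(n, k) ^ 2 * 'C(2 * k, k) * 'C(2 * N, N) * n * (n - k) ^ 2 = Y * n)%N.
  transitivity (((n - k) * 'C(n, k)) ^ 2 * ('C(2 * k, k) * 'C(2 * N, N)) * n)%N.
    by ring.
  by rewrite bin_n /Y; ring.
transitivity (\sum_(1 <= j < p./2.+1)
    (- 4 * (Y * n)%:R * (q ^+ 3 * j%:R ^- 3)) : R).
  apply: eq_big_nat => j j_int.
  have := @summand_offblock21 k N j; rewrite -En => -> //.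
  have := @summand_offblock21 N k j; rewrite -En' => -> //.
  have -> : (n ^ 2 * 'C(k + N, k) ^ 2 * 'C(2 * k, k) * 'C(2 * N, N) * (2 * N + 1)
     = Y * (2 * N + 1))%N by rewrite /Y; ring.
  have -> : (n ^ 2 * 'C(N + k, N) ^ 2 * 'C(2 * N, N) * 'C(2 * k, k) * (2 * k + 1)
     = Y * (2 * k + 1))%N by rewrite bin_N /Y; ring.
  have En2 : (n%:R = k%:R + N%:R + 1 :> R) by rewrite {1}En natrD -natr1 addrA.
  have EY i : (Y * (2 * i + 1))%:R = Y%:R * (2 * i%:R + 1) :> R.
    by rewrite natrM natrD natrM.
  by rewrite !EY natrM En2; ring.
by rewrite -mulr_sumr -mulr_sumr Eh; ring.
Qed.

Lemma sum_summand_mulp r s n : (2 <= r)%N -> (0 < s)%N ->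
  exists2 b, reduces (bernoulli (p - 3)) b &
  \sum_(m < (n * p).+1) (summand r s (n * p) m)%:R =
  \sum_(k < n.+1) (summand r s n k)%:R + q ^+ 3 * b * calD_ring r s n.
Proof.
move=> r_ge2 s_gt0; have [b Hb [Etheta Eh]] := theta_bernoulli.
exists b => //; rewrite sum_offblocks (sum_multiples _ _ _ Etheta) -addrA.
congr (_ + _); rewrite /calD_ring; case: ifP => [/andP[/eqP -> /eqP ->]|not21].
  rewrite (sum_nonmultiples21 _ Eh) [in RHS]mulrDr addrC -mulNr.
  congr (_ + _ * (_ * _)); apply: eq_bigr => k _.
  by rewrite expn1 !muln1 mulnA.
rewrite [X in _ + X]big1 ?addr0 // => k _; have lt_kn := ltn_ord k.
rewrite big_nat_cond big1 // => j; rewrite andbT => j_int.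
have le4 : (4 <= r + s)%N by lia.
have := @summand_offblock_eq0 k (n - k.+1) j j_int r s s_gt0 le4.
have := @summand_offblock_eq0 (n - k.+1) k j j_int r s s_gt0 le4.
have -> : (k + (n - k.+1).+1 = n)%N by lia.
have -> : (n - k.+1 + k.+1 = n)%N by lia.
by move=> -> ->; rewrite addr0.
Qed.

End ModuloFourthPower.

(** * Return from Z/p^4 to congruences between rationals *)

Lemma Zp_intr_eq0 (N : nat) (a : int) : (1 < N)%N ->
  a%:~R = 0 :> 'Z_N -> (N%:Z %| a)%Z.
Proof.
move=> N_gt1; have nat_eq0 k : k%:R = 0 :> 'Z_N -> (N %| k)%N.
  by move/(congr1 val); rewrite /= val_Zp_nat // => /eqP.
case: a => k; first exact: nat_eq0.
by rewrite NegzE mulrNz => /eqP; rewrite oppr_eq0 => /eqP /nat_eq0.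
Qed.

(** Here x d = a with d prime to p and p^m dividing a, so d clears the denominator of x/p^m, which
    therefore divides d by Gauss. *)
Lemma reduces_eq0 (p m : nat) (x : rat) : prime p -> (0 < m)%N ->
  reduces p x (0 : 'Z_(p ^ m)) -> ~~ (p%:Z %| denq (x / (p ^ m)%:R))%Z.
Proof.
move=> p_pr m_gt0 [a [d co_pd [Ex]]]; rewrite mul0r => /esym a0.
have pm_gt1 : (1 < p ^ m)%N by rewrite -{1}(exp1n m) ltn_exp2r // prime_gt1.
have /dvdzP[c Ea] := Zp_intr_eq0 pm_gt1 a0.
set y := x / _; have Ey : y * d%:R = c%:~R.
  rewrite /y mulrAC Ex Ea intrM mulfK //.
  by rewrite pnatr_eq0 -lt0n (ltnW pm_gt1).
have den_d : (denq y %| d%:Z)%Z.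
  have co : coprimez (denq y) (numq y) by rewrite coprimez_sym; exact: coprime_num_den.
  rewrite -(Gauss_dvdzr _ co); apply/dvdzP; exists c.
  apply: (@intr_inj rat); rewrite !intrM numqE -Ey; ring.
apply: contraL co_pd => p_den; rewrite prime_coprime // negbK.
exact: (dvdz_trans p_den den_d).
Qed.

Theorem theorem2p1 (p r s n : nat) :
  prime p -> (5 <= p)%N -> (2 <= r)%N -> (0 < s)%N -> (0 < n)%N ->
  rat_congr p 4 (Drs r s (n * p))
    (Drs r s n + (p ^ 3)%:R * bernoulli (p - 3) * calD r s n).
Proof.
move=> p_pr p_ge5 r_ge2 s_gt0 _; apply: reduces_eq0 => //.
have q4 : p%:R ^+ 4 = 0 :> 'Z_(p ^ 4).
  by rewrite -natrX pchar_Zp // -{1}(exp1n 4) ltn_exp2r // prime_gt1.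
have [b Hb E] := sum_summand_mulp p_pr p_ge5 q4 n r_ge2 s_gt0.
have reduces_Drs N : reduces p (Drs r s N)
    (\sum_(k < N.+1) (summand r s N k)%:R : 'Z_(p ^ 4)).
  by apply: reduces_sum => k _; apply: reduces_nat.
(* Zero is rewritten as the image of the left side minus that of the right side, so the reduction
   can be checked termwise. *)
rewrite -(subrr (\sum_(m < (n * p).+1) (summand r s (n * p) m)%:R)) {2}E.
apply: reducesD => //; apply/reducesN/reducesD => //.
apply: reducesM; last exact: reduces_calD.
by apply: reducesM => //; rewrite -natrX; apply: reduces_nat.
Qed.
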